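(* Let $\Omega=(-1,1)$, $u_0\in C_0^+([-1,1])$, $a\in\mathbb{R}$, $a\ne0$, and let $u$ be the unique classical solution in $Q_\infty=(0,\infty)\times(-1,1)$ to $$u_t-u_{xx}=a|u_x| \ \text{ in } (0,\infty)\times(-1,1),\qquad u(t,\pm1)=0\ \text{ for } t>0,\qquad u(0,\cdot)=u_0\ \text{ in }(-1,1).$$ Then there is a positive constant $\gamma(a)$ depending only on $a$ and $\Omega$ such that $$\|u(t)\|_\infty\le\gamma(a)\,\|u_0\|_\infty\,e^{-((a^2/4)+\alpha_1)t},\qquad t\ge1,$$ where $\alpha_1$ is the first (smallest) eigenvalue of the unbounded linear operator $L$ of $L^2(0,1)$ with domain $$D(L)=\{\varphi\in W^{2,2}(0,1)\ :\ a\varphi(0)+2\varphi_x(0)=\varphi(1)=0\}$$ defined by $L(\varphi)=-\varphi_{xx}$ for $\varphi\in D(L)$.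
   Context: $C_0^+([-1,1])$ is the set of non-negative continuous functions on $[-1,1]$ vanishing at $\pm1$; $\|\cdot\|_\infty$ is the norm of $L^\infty(-1,1)$. A classical solution in $Q_\infty$ is a function $u\in C([0,\infty)\times[-1,1])$ with $u_t,u_x,u_{xx}$ existing and continuous in $Q_\infty$, with $u(0)=u_0$, satisfying the equation pointwise in $Q_\infty$ and the boundary conditions. It is known that such a solution exists and is unique for every $u_0\in C_0([-1,1])$. The spectrum of $L$ is an increasing sequence $(\alpha_n)_{n\ge1}$ of real eigenvalues converging to $\infty$. *)

(* Defs.v *)
From mathcomp Require Import all_boot all_order all_algebra.
From mathcomp Require Import all_classical all_reals all_analysis.

Set Implicit Arguments.
Unset Strict Implicit.
Unset Printing Implicit Defensive.

Import Order.TTheory GRing.Theory Num.Theory.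
Import numFieldNormedType.Exports.

Local Open Scope classical_set_scope.
Local Open Scope ring_scope.

Section Sobolev.
Variable R : realType.
Implicit Types f g phi psi : R -> R.

(* Elements of L^p of an interval are given by representatives R -> R whose
   values outside the interval are irrelevant; they are extended by zero to
   use the L^p spaces and norms of Lebesgue measure on R. *)
Definition zero_extension (D : set R) f : R -> R := f \_ D.

Definition ae_eq_01 f g : Prop := f = g %[ae lebesgue_measure in `]0, 1[%classic].

Definition in_L2_01 f : Prop :=
  zero_extension `]0, 1[ f \in Lfun lebesgue_measure 2%:E.

Definition Linfty_norm f : \bar R :=
  Lnorm lebesgue_measure +oo%E (EFin \o zero_extension `]-1, 1[ f).

(* C_c^1(0,1) *)
Definition test_function_01 psi : Prop :=
  [/\ forall x, derivable psi x 1,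
      continuous (derive1 psi) &
      closure [set x | psi x != 0] `<=` `]0, 1[ ].

(* The test functions are C_c^1, as in Brezis' definition of W^{1,p}(I);
   taking them C_c^oo yields the same weak derivatives. *)
Definition weak_derivative_01 f g : Prop :=
  forall psi, test_function_01 psi ->
    \int[lebesgue_measure]_(x in `]0, 1[) (f x * derive1 psi x) =
    - \int[lebesgue_measure]_(x in `]0, 1[) (g x * psi x).

(* phi is in W^{2,2}(0,1), with weak derivatives phi_x and phi_xx. *)
Record W22_01 (phi phi_x phi_xx : R -> R) : Prop := {
  W22_L2 : in_L2_01 phi;
  W22_L2_x : in_L2_01 phi_x;
  W22_L2_xx : in_L2_01 phi_xx;
  W22_weak_x : weak_derivative_01 phi phi_x;
  W22_weak_xx : weak_derivative_01 phi_x phi_xx }.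

(* Pointwise values at 0 and 1 of an element of W^{1,2}(0,1) are those of its
   (unique) representative that is continuous on [0,1]. *)
Definition continuous_representative_01 f g : Prop :=
  {within `[0, 1], continuous g} /\ ae_eq_01 f g.

End Sobolev.

Section OperatorL.
Variables (R : realType) (a : R).

(* The conditions a * phi(0) + 2 * phi_x(0) = phi(1) = 0. *)
Definition boundary_L (phi phi_x : R -> R) : Prop :=
  exists g g_x : R -> R,
    [/\ continuous_representative_01 phi g,
        continuous_representative_01 phi_x g_x,
        a * g 0 + 2 * g_x 0 = 0 &
        g 1 = 0].

(* The graph of the unbounded operator L of L^2(0,1): phi is in D(L) and
   L(phi) = psi in L^2(0,1). *)
Definition graph_L (phi psi : R -> R) : Prop :=
  exists phi_x phi_xx : R -> R,
    [/\ W22_01 phi phi_x phi_xx,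
        boundary_L phi phi_x &
        ae_eq_01 psi (fun x => - phi_xx x)].

Definition eigenvalue_L (alpha : R) : Prop :=
  exists phi : R -> R,
    ~ ae_eq_01 phi (cst 0) /\
    graph_L phi (fun x => alpha * phi x).

Definition first_eigenvalue_L (alpha1 : R) : Prop :=
  eigenvalue_L alpha1 /\ forall alpha, eigenvalue_L alpha -> alpha1 <= alpha.

End OperatorL.

Section Problem.
Variable R : realType.

(* C_0^+([-1,1]) *)
Definition C0_plus (u0 : R -> R) : Prop :=
  [/\ {within `[-1, 1], continuous u0},
      forall x, -1 <= x <= 1 -> 0 <= u0 x,
      u0 (-1) = 0 &
      u0 1 = 0].

Definition Q_infty : set (R * R) := [set p | 0 < p.1 /\ -1 < p.2 < 1].

Definition cQ_infty : set (R * R) := [set p | 0 <= p.1 /\ -1 <= p.2 <= 1].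

(* Only the values of u on [0,oo) x [-1,1] are relevant; the first argument
   of u is the time t, the second the position x. *)
Record classical_solution (a : R) (u0 : R -> R) (u : R -> R -> R) : Prop := {
  sol_continuous :
    {within cQ_infty, continuous (fun p => u p.1 p.2)};
  sol_derivable_t :
    forall t x, Q_infty (t, x) -> derivable (u ^~ x) t 1;
  sol_derivable_x :
    forall t x, Q_infty (t, x) -> derivable (u t) x 1;
  sol_derivable_xx :
    forall t x, Q_infty (t, x) -> derivable (derive1 (u t)) x 1;
  sol_continuous_t :
    {within Q_infty, continuous (fun p => derive1 (u ^~ p.2) p.1)};
  sol_continuous_x :
    {within Q_infty, continuous (fun p => derive1 (u p.1) p.2)};
  sol_continuous_xx :
    {within Q_infty, continuous (fun p => derive1 (derive1 (u p.1)) p.2)};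
  sol_equation :
    forall t x, Q_infty (t, x) ->
      derive1 (u ^~ x) t - derive1 (derive1 (u t)) x = a * `|derive1 (u t) x|;
  sol_boundary :
    forall t, 0 < t -> u t (-1) = 0 /\ u t 1 = 0;
  sol_initial :
    forall x, -1 <= x <= 1 -> u 0 x = u0 x }.

End Problem.

(* Main.v *)
(* Only the minimality of [alpha1] matters: it suffices to exhibit one
   eigenvalue [al] of [L] with an explicit eigenfunction [phi] that is positive
   on [0, 1) -- a sine, affine or hyperbolic sine in [1 - x], according to the
   position of [a] with respect to 2 -- and to prove decay at the rate
   [lam = a^2/4 + al >= a^2/4 + alpha1].  Then [Phi(x) = e^(ax/2) phi(x)] is
   decreasing with [Phi'(0) = 0] and [- Phi'' - a |Phi'| = lam Phi], so
   [A e^(- lam t) Phi(|x|)] is an even solution of the equation.  To compare it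
   with [u] from time 1 on one needs [u(1, x) <= A Phi(|x|)] with [A]
   proportional to [max u0]; this follows from a linear bound in [1 - |x|],
   obtained on [0, 1] from a parabolic barrier supported by a layer of width
   [c t + d] at the boundary, [d -> 0]. *)

Require Import Defs.
From mathcomp Require Import all_boot all_order all_algebra.
From mathcomp Require Import all_classical all_reals all_analysis.
From mathcomp Require Import ess_sup_inf measurable_realfun ring lra.

Import Order.TTheory GRing.Theory Num.Theory.
Import numFieldNormedType.Exports.

Local Open Scope classical_set_scope.
Local Open Scope ring_scope.

(** * Differentiation rules on the real line *)

Section Derivative_rules.
Context {R : realType}.
Implicit Types (f g : R -> R) (x k l df dg : R).

Lemma is_derive_derive1 f x : derivable f x 1 ->
  is_derive x 1 f (derive1 f x).
Proof. by move=> fx; rewrite derive1E; exact: derivableP. Qed.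

Lemma is_derive_continuous f (f1 : R -> R) :
  (forall x, is_derive x 1 f (f1 x)) -> continuous f.
Proof.
move=> fd x; apply: differentiable_continuous; apply/derivable1_diffP.
by have [] := fd x.
Qed.

Lemma is_derive_mul f g x df dg : is_derive x 1 f df -> is_derive x 1 g dg ->
  is_derive x 1 (fun y => f y * g y) (df * g x + f x * dg).
Proof.
move=> fx gx; apply: (is_derive_eq (is_deriveM fx gx)).
by rewrite addrC [_ *: df]mulrC.
Qed.

Lemma is_derive_mull k f x df : is_derive x 1 f df ->
  is_derive x 1 (fun y => k * f y) (k * df).
Proof. exact: is_deriveZ. Qed.

Lemma is_derive_addr f k x df : is_derive x 1 f df ->
  is_derive x 1 (fun y => f y + k) df.
Proof.
by move=> fx; rewrite -[df]addr0; apply: is_deriveD; exact: is_derive_cst.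
Qed.

Lemma is_derive_subl k f x df : is_derive x 1 f df ->
  is_derive x 1 (fun y => k - f y) (- df).
Proof.
by move=> fx; rewrite -[- df]sub0r; apply: is_deriveB; exact: is_derive_cst.
Qed.

Lemma is_derive_affine k l x : is_derive x 1 (fun y => k * y + l) k.
Proof.
have := is_derive_addr _ l _ _ (is_derive_mull k _ _ _ (is_derive_id x 1)).
by rewrite mulr1.
Qed.

Lemma is_derive_comp_opp f x df : is_derive (- x) 1 f df ->
  is_derive x 1 (fun y => f (- y)) (- df).
Proof.
by move=> fd; rewrite -mulrN1; exact: is_derive1_comp fd (is_deriveNid _ _).
Qed.

Lemma is_derive_inv f x df : f x != 0 -> is_derive x 1 f df ->
  is_derive x 1 (fun y => (f y)^-1) (- (df / f x ^+ 2)).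
Proof.
move=> fx0 [fx dE]; apply: DeriveDef; first exact: derivableV.
by rewrite deriveV// dE [_ *: _]mulrC mulrN.
Qed.

Lemma is_derive_expR_mull k x :
  is_derive x 1 (fun y => expR (k * y)) (k * expR (k * x)).
Proof.
have := is_derive1_comp (is_derive_expR (k * x))
  (is_derive_mull k _ _ _ (is_derive_id x 1)).
by rewrite mulr1 mulrC.
Qed.

End Derivative_rules.

(** * One-sided first and second derivative tests at a maximum *)

Section Derivative_tests.
Context {R : realType}.
Implicit Types (f : R -> R) (x d : R).

Lemma gt0_derive_right f x d : is_derive x 1 f d -> 0 < d ->
  \forall y \near x^'+, f x < f y.
Proof.
move=> [df dE] d0.
have cv : (fun h => h^-1 *: ((f \o shift x) (h *: 1) - f x)) @ 0^' --> d.
  by rewrite -dE; exact: df.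
have /= := cvgr_gt d cv 0 d0.
move=> [e /= e0 He].
exists e => //= y /= xye xy.
have yx0 : 0 < y - x by rewrite subr_gt0.
have := He (y - x); rewrite /= sub0r normrN => /(_ _ _)/=.
rewrite distrC [_%:A]mulr1 subrK [X in 0 < X]mulrC.
by rewrite pmulr_lgt0 ?invr_gt0// subr_gt0; apply => //; rewrite gt_eqF.
Qed.

Lemma max_right_derive_le0 f x d : is_derive x 1 f d ->
  (\forall y \near x^'+, f y <= f x) -> d <= 0.
Proof.
move=> fd fmax; rewrite leNgt; apply/negP => d0.
have : \forall y \near x^'+, False.
  near=> y; have : f x < f y by near: y; exact: gt0_derive_right fd d0.
  by rewrite ltNge => /negP; apply; near: y.
by move=> /filter_ex[].
Unshelve. all: by end_near. Qed.

Lemma max_left_derive_ge0 f x d : is_derive x 1 f d ->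
  (\forall y \near x^'-, f y <= f x) -> 0 <= d.
Proof.
move=> fd fmax; rewrite -oppr_le0.
apply: (@max_right_derive_le0 (fun y => f (- y)) (- x)).
  by apply: is_derive_comp_opp; rewrite opprK.
case: fmax => e /= e0 He; exists e => //= y /= xye xy.
rewrite opprK; apply: He => /=; last by rewrite ltrNl.
by rewrite opprK -normrN opprD.
Qed.

(** If [d > 0], then [f1] is positive just to the right of its zero [x], and the mean value theorem
    makes [f] exceed [f x] there. *)
Lemma max_right_derive2_le0 f (f1 : R -> R) x d :
  (\forall y \near x, is_derive (y : R) 1 f (f1 y)) -> is_derive x 1 f1 d ->
  f1 x = 0 -> (\forall y \near x^'+, f y <= f x) -> d <= 0.
Proof.
move=> ff1 f1d f1x fmax; rewrite leNgt; apply/negP => d0.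
have [e1 /= e10 H1] := ff1.
have [e2 /= e20 H2] := gt0_derive_right _ _ _ f1d d0.
have [e3 /= e30 H3] := fmax.
pose e := Num.min e1 (Num.min e2 e3) / 2.
have e0 : 0 < e by rewrite divr_gt0// !lt_min e10 e20.
have le_e : [/\ e < e1, e < e2 & e < e3].
  have : [&& e * 2 <= e1, e * 2 <= e2 & e * 2 <= e3].
    by rewrite -!le_min /e divfK.
  by move=> /and3P[? ? ?]; split; lra.
case: le_e => ee1 ee2 ee3.
have xye y : x <= y <= x + e -> `|x - y| <= e by move=> ?; rewrite ler_norml; lra.
have fd y : x <= y <= x + e -> is_derive y 1 f (f1 y).
  by move=> xy; apply: H1 => /=; apply: le_lt_trans ee1; exact: xye.
have [|||c cI Ec] := @MVT R f f1 x (x + e).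
- by rewrite ltrDl.
- by move=> y; rewrite in_itv/= => /andP[? ?]; apply: fd; lra.
- apply: derivable_within_continuous => y; rewrite in_itv/= => yI.
  by have [] := fd _ yI.
have fle : f (x + e) <= f x.
  by apply: H3 => /=; [apply: le_lt_trans ee3; apply: xye; lra|lra].
move: cI; rewrite in_itv/= => /andP[c1 c2].
have f1c : 0 < f1 c.
  by rewrite -f1x; apply: H2 => //=; apply: le_lt_trans ee2; apply: xye; lra.
have : 0 < f1 c * (x + e - x) by rewrite mulr_gt0//; lra.
lra.
Qed.

End Derivative_tests.

(** * Comparison of subsolutions with even supersolutions *)

Section Comparison.
Context {R : realType}.
Implicit Types (b s T t x : R) (u W : R -> R -> R).

Record subsolution b u : Prop := {
  subsol_derivable_t :
    forall t x, Q_infty (t, x) -> derivable (u ^~ x) t 1;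
  subsol_derivable_x :
    forall t x, Q_infty (t, x) -> derivable (u t) x 1;
  subsol_derivable_xx :
    forall t x, Q_infty (t, x) -> derivable (derive1 (u t)) x 1;
  subsol_le :
    forall t x, Q_infty (t, x) ->
      derive1 (u ^~ x) t - derive1 (derive1 (u t)) x <=
      b * `|derive1 (u t) x| }.

(* Supersolutions are functions of (t, |x|); the condition at x = 0 makes
   the even extension C^1 there. *)
Definition supersolution_at b W t x : Prop :=
  exists (wt wxx : R) (wx : R -> R),
    [/\ is_derive t 1 (W ^~ x) wt,
        \forall y \near x, is_derive (y : R) 1 (W t) (wx y),
        is_derive x 1 wx wxx,
        x = 0 -> wx x = 0 &
        wxx + b * `|wx x| <= wt].

(* At [x0 = 0] the maximum of [u(t0, x) - W(t0, |x|)] gives [u_x = W_x = 0],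
   and the second derivative test is applied on the right only, so the even
   extension of [W] need not be twice differentiable. *)
Lemma supersolution_not_touched b u W s t0 x0 (eta : R) :
  subsolution b u -> supersolution_at b W t0 x0 ->
  0 <= s < t0 -> 0 <= x0 < 1 -> 0 < eta ->
  ~ (forall t x, s <= t <= t0 -> -1 <= x <= 1 ->
       u t x - W t `|x| - eta * t <= u t0 x0 - W t0 x0 - eta * t0).
Proof.
move=> [ut ux uxx ule] [wt [wxx [wx [Wt Wx Wxx wx0 Wle]]]] st0 x01 eta0 umax.
have Q0 : Q_infty (t0, x0) by split => /=; lra.
have absx0 : `|x0| = x0 by rewrite ger0_norm//; lra.
(* Only earlier times are available, so the maximum in time is one-sided: it gives
   [u_t >= W_t + eta], not equality. *)
have dt : 0 <= derive1 (u ^~ x0) t0 - wt - eta.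
  apply: (@max_left_derive_ge0 _ (fun t => u t x0 - W t x0 - eta * t) t0).
    apply: is_deriveB.
      by apply: is_deriveB; exact/is_derive_derive1/ut.
    by have := is_deriveZ eta (is_derive_id t0 1); rewrite [_%:A]mulr1.
  near=> t; have tt0 : s <= t <= t0.
    apply/andP; split; near: t; last exact: nbhs_left_le.
    by apply: nbhs_left_ge; lra.
  by have := umax t x0 tt0; rewrite absx0; apply; lra.
have umaxx x : -1 <= x <= 1 -> u t0 x - W t0 `|x| <= u t0 x0 - W t0 x0.
  by move=> x1; have := umax t0 x _ x1; rewrite lerD2r; apply; lra.
have umax_right : \forall x \near x0^'+,
    u t0 x - W t0 x <= u t0 x0 - W t0 x0.
  near=> x; have xx0 : x0 < x < 1.
    apply/andP; split; near: x; first exact: nbhs_right_gt.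
    by apply: nbhs_right_lt; lra.
  by have := umaxx x; rewrite ger0_norm; [apply|]; lra.
have dx : is_derive x0 1 (fun x => u t0 x - W t0 x)
    (derive1 (u t0) x0 - wx x0).
  apply: is_deriveB; first exact/is_derive_derive1/ux.
  exact: nbhs_singleton Wx.
have ux_le := max_right_derive_le0 _ _ _ dx umax_right.
have ux_ge : 0 <= derive1 (u t0) x0 - wx x0.
  have [x0_gt0|x0_le0] := ltP 0 x0.
    apply: max_left_derive_ge0 dx _; near=> x; have xx0 : 0 < x <= x0.
      apply/andP; split; near: x; first exact: nbhs_left_gt.
      exact: nbhs_left_le.
    by have := umaxx x; rewrite ger0_norm; [apply|]; lra.
  (* At the fold, comparing [u] at [- x] with [W] at [x] gives [- u_x <= W_x = 0], which is the
     missing inequality. *)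
  have x00 : x0 = 0 by lra.
  have : - derive1 (u t0) 0 - wx 0 <= 0.
    apply: (@max_right_derive_le0 _ (fun x => u t0 (- x) - W t0 x) 0).
      apply: is_deriveB; last by rewrite -x00; exact: nbhs_singleton Wx.
      apply: is_derive_comp_opp; rewrite oppr0 -x00.
      exact/is_derive_derive1/ux.
    near=> x; have xx0 : 0 < x < 1.
      by apply/andP; split; near: x; [exact: nbhs_right_gt|exact: nbhs_right_lt].
    by have := umaxx (- x); rewrite x00 normrN oppr0 ger0_norm; [apply|]; lra.
  by have := wx0 x00; rewrite x00 => ->; lra.
have uxE : derive1 (u t0) x0 = wx x0 by lra.
have dxx : derive1 (derive1 (u t0)) x0 - wxx <= 0.
  apply: (@max_right_derive2_le0 _ (fun x => u t0 x - W t0 x)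
    (fun x => derive1 (u t0) x - wx x) x0) => //.
  - near=> x; apply: is_deriveB.
      apply/is_derive_derive1/ux; split => /=; first by lra.
      apply/andP; split; near: x; first by apply: lt_nbhsr; lra.
      by apply: lt_nbhsl; lra.
    by near: x.
  - by apply: is_deriveB; exact/is_derive_derive1/uxx.
  - by rewrite uxE subrr.
(* The contradiction comes from [eta]: [u_t - u_xx >= wt - wxx + eta > b |wx| = b |u_x|]. *)
have := ule _ _ Q0; rewrite uxE; lra.
Unshelve. all: by end_near. Qed.

(** The first space derivative enters only through its absolute value, so the inequality is
    invariant under [x -> - x]. This moves a maximum at negative [x] to the right half. *)
Lemma subsolution_reflect b u :
  subsolution b u -> subsolution b (fun t x => u t (- x)).
Proof.
move=> [ut ux uxx ule].
have Qo t x : Q_infty (t, x) -> Q_infty (t, - x).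
  by move=> [/= ? ?]; split => //=; lra.
have dx t x : Q_infty (t, x) ->
    is_derive x 1 (fun y => u t (- y)) (- derive1 (u t) (- x)).
  by move=> /Qo ?; apply: is_derive_comp_opp; exact/is_derive_derive1/ux.
have dxx t x : Q_infty (t, x) ->
    is_derive x 1 (derive1 (fun y => u t (- y))) (derive1 (derive1 (u t)) (- x)).
  move=> Qtx.
  apply: (@near_eq_is_derive _ _ _ (fun y => - derive1 (u t) (- y))).
    case: Qtx => /= t0 x1.
    near=> y; have Qty : Q_infty (t, y).
      by split => //=; apply/andP; split; near: y;
        [apply: lt_nbhsr|apply: lt_nbhsl]; lra.
    by rewrite [RHS]derive1E; have [_ ->] := dx _ _ Qty.
  rewrite -[X in is_derive _ _ _ X]opprK; apply: is_deriveN.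
  by apply: is_derive_comp_opp; exact/is_derive_derive1/uxx/Qo.
split=> t x Qtx.
- exact/ut/Qo.
- by have [] := dx _ _ Qtx.
- by have [] := dxx _ _ Qtx.
- have := ule _ _ (Qo _ _ Qtx).
  have -> : derive1 (derive1 (fun y => u t (- y))) x =
      derive1 (derive1 (u t)) (- x).
    by rewrite [LHS]derive1E; have [_ ->] := dxx _ _ Qtx.
  have -> // : `|derive1 (fun y => u t (- y)) x| = `|derive1 (u t) (- x)|.
  by rewrite [X in `|X|]derive1E; have [_ ->] := dx _ _ Qtx; rewrite normrN.
Unshelve. all: by end_near. Qed.

(** If the claim fails, the maximum of [u - W - eta t] over the compact slab lies where [W < u],
    hence neither at time [s] nor on the lateral boundary, and [supersolution_not_touched] applies
    there. Since only points with [W < u] matter, [W] has to be a supersolution at those points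
    alone. The sign of [b] is free because [|u_x| = |W_x|] at the maximum. *)
Lemma comparison_principle b u W s T : subsolution b u -> 0 <= s ->
  {within `[s, T] `*` `[-1, 1], continuous (fun p => u p.1 p.2)} ->
  {within `[s, T] `*` `[-1, 1], continuous (fun p => W p.1 `|p.2|)} ->
  (forall x, -1 <= x <= 1 -> u s x <= W s `|x|) ->
  (forall t, s <= t <= T -> u t (-1) <= W t 1 /\ u t 1 <= W t 1) ->
  (forall t x, s < t <= T -> 0 <= x < 1 ->
     W t x < u t x \/ W t x < u t (- x) -> supersolution_at b W t x) ->
  forall t x, s <= t <= T -> -1 <= x <= 1 -> u t x <= W t `|x|.
Proof.
move=> usub s0 uC WC uW_init uW_bd Wsup t1 x1 t1I x1I.
rewrite leNgt; apply/negP => Wu1.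
have st1 : s < t1.
  rewrite lt_neqAle; apply/andP; split; last by lra.
  by apply/eqP => st1; move: Wu1; rewrite -st1 ltNge uW_init.
pose gap := u t1 x1 - W t1 `|x1|; have gap0 : 0 < gap by rewrite subr_gt0.
(* With this [eta], the penalty between [s] and [t1] consumes only half of the gap, so [W < u]
   persists at the maximum point. *)
pose eta := gap / (2 * (t1 - s)).
have eta0 : 0 < eta by rewrite divr_gt0// mulr_gt0//; lra.
have etaE : eta * (t1 - s) = gap / 2 by rewrite /eta; field; lra.
have K0 : (`[s, T] `*` `[-1, 1] : set (R * R)) !=set0.
  by exists (t1, x1); split; rewrite /= in_itv/=.
have Kc : compact (`[s, T] `*` `[-1, 1] : set (R * R)).
  by apply: compact_setX; exact: segment_compact.
have hC : {within `[s, T] `*` `[-1, 1],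
    continuous (fun p => u p.1 p.2 - W p.1 `|p.2| - eta * p.1)}.
  have lC : {within `[s, T] `*` `[-1, 1], continuous (fun p : R * R => eta * p.1)}.
    apply: continuous_subspaceT => q.
    by apply: cvgM; [exact: cvg_cst|exact: cvg_fst].
  move=> p; apply: cvgB; last exact: lC.
  by apply: cvgB; [exact: uC|exact: WC].
have [[t0 x0]] := compact_EVT_max K0 Kc hC.
rewrite inE /= => -[/=]; rewrite !in_itv/= => t0I x0I umax'.
have {}umax t x : s <= t <= T -> -1 <= x <= 1 ->
    u t x - W t `|x| - eta * t <= u t0 x0 - W t0 `|x0| - eta * t0.
  by move=> ? ?; apply: (umax' (t, x)); rewrite inE; split; rewrite /= in_itv.
have Wu0 : W t0 `|x0| < u t0 x0.
  by have := umax _ _ t1I x1I; have : 0 <= eta * (t0 - s) by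
    [rewrite mulr_ge0//; lra]; rewrite /gap in etaE; lra.
have st0 : s < t0.
  rewrite lt_neqAle; apply/andP; split; last by lra.
  by apply/eqP => st0; move: Wu0; rewrite -st0 ltNge uW_init.
have [x0N1 x0n1] : x0 != -1 /\ x0 != 1.
  have [bd1 bd2] := uW_bd _ t0I.
  split; apply/eqP => x0E; move: Wu0; rewrite x0E ltNge ?normrN normr1.
    by rewrite bd1.
  by rewrite bd2.
have {}x0I : -1 < x0 < 1 by rewrite !lt_neqAle eq_sym x0N1 x0n1.
have [x00|x00] := leP 0 x0.
  rewrite ger0_norm// in Wu0.
  have W0 := Wsup t0 x0 ltac:(lra) ltac:(lra) (or_introl Wu0).
  apply: (supersolution_not_touched _ _ _ s _ _ eta usub W0) => // [||t x tI xI].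
  - by lra.
  - by lra.
  - by have := umax t x; rewrite (ger0_norm x00); apply; lra.
rewrite ltr0_norm// in Wu0.
have W0 : supersolution_at b W t0 (- x0).
  by apply: Wsup; [lra|lra|right; rewrite opprK].
apply: (supersolution_not_touched _ _ _ s _ _ eta
    (subsolution_reflect _ _ usub) W0)
  => // [||t x tI xI].
- by lra.
- by lra.
- by have := umax t (- x); rewrite (ltr0_norm x00) normrN opprK; apply; lra.
Qed.

End Comparison.

(** * A parabolic barrier in an expanding boundary layer *)

Section Barrier.
Context {R : realType}.
Variables (M eps c d : R).
Implicit Types (a t x : R).

(* The profile [1 - (1 - z)_+^2] rises from 0 to 1 on the layer
   [0 <= z <= 1], where [z = (1 - x) / (c t + d)]; outside the layer, the
   comparison relies on [u <= M]. *)
Definition barrier t x : R :=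
  M * (1 - (Num.max 0 (1 - (1 - x) / (c * t + d))) ^+ 2) + eps.

Lemma barrierE t x : 0 < c * t + d -> 1 - x <= c * t + d ->
  barrier t x = M * (1 - (1 - (1 - x) / (c * t + d)) ^+ 2) + eps.
Proof.
move=> S0 xS; rewrite /barrier max_r// subr_ge0 ler_pdivrMr//; lra.
Qed.

Let is_derive_profile (w : R -> R) x (dw : R) : is_derive x 1 w dw ->
  is_derive x 1 (fun y => M * (1 - (w y) ^+ 2) + eps) (- (2 * M * w x * dw)).
Proof.
move=> wx; apply/is_derive_addr.
have := is_derive_mull M _ _ _
  (is_derive_subl 1 _ _ _ (is_derive_mul _ _ _ _ _ wx wx)).
by move=> /is_derive_eq; apply; ring.
Qed.

(** Inside the layer the concavity term [- 2 M / S^2] dominates: after factoring out [2 M / S^2],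
    the time derivative and the gradient term contribute at most [1/4] and [1/2]. *)
Lemma barrier_supersolution a t x : 0 <= M -> 0 <= c <= 1/4 ->
  c * t + d < 1 -> `|a| * (c * t + d) <= 1/2 ->
  x < 1 -> 1 - x < c * t + d -> supersolution_at a barrier t x.
Proof.
move=> M0 c01 S1 aS x1 xS; set S := c * t + d in S1 aS xS.
have S0 : 0 < S by lra.
pose w (y : R) : R := 1 - (1 - y) / S.
have dw (y : R) : is_derive y 1 w S^-1.
  rewrite /w -[X in is_derive _ _ _ X]opprK; apply/is_derive_subl.
  have := is_derive_mul _ _ y _ _ (is_derive_subl 1 _ _ _ (is_derive_id y 1))
    (is_derive_cst S^-1 y 1).
  by move=> /is_derive_eq; apply; rewrite mulr0 addr0 mulN1r.
exists (- (2 * M * w x * ((1 - x) * (c / S ^+ 2)))).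
exists (- (2 * M * S^-1 * S^-1)), (fun y => - (2 * M * w y * S^-1)); split.
- apply: (@near_eq_is_derive _ _ _
    (fun s => M * (1 - (1 - (1 - x) / (c * s + d)) ^+ 2) + eps)).
    have : {for t, continuous (fun s => c * s + d)}.
      exact: is_derive_continuous (is_derive_affine c d) t.
    move=> /cvgr_gt/(_ _ xS); apply: filterS => s /= xs.
    by rewrite barrierE; lra.
  apply: (is_derive_profile (fun s => 1 - (1 - x) / (c * s + d))).
  rewrite -[X in is_derive _ _ _ X]opprK; apply/is_derive_subl.
  rewrite -mulrN; apply: is_derive_mull.
  by apply: is_derive_inv; [rewrite gt_eqF|exact: is_derive_affine].
- have xS' : 1 - S < x by lra.
  near=> y; have yS : 1 - S < y by near: y; exact: lt_nbhsr.
  apply: (@near_eq_is_derive _ _ _ (fun y => M * (1 - (w y) ^+ 2) + eps)).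
    near=> z; have zS : 1 - S < z by near: z; exact: lt_nbhsr.
    by rewrite barrierE//; rewrite -/S; lra.
  exact: is_derive_profile.
- have := is_derive_mull (- (2 * M * S^-1)) _ _ _ (dw x).
  rewrite mulNr; congr (is_derive _ _ _ _).
  by apply/funext => y; ring.
(* The condition at the fold is vacuous: a layer of width [S < 1] stays in [x > 0]. *)
- by move=> x0; lra.
- have w0 : 0 <= w x by rewrite /w subr_ge0 ler_pdivrMr//; lra.
  have w1 : w x <= 1 by rewrite /w lerBlDr lerDl divr_ge0//; lra.
  have a1 : a * `|- (2 * M * w x / S)| <= `|a| * (2 * M * w x / S).
    rewrite normrN (ger0_norm (_ : 0 <= 2 * M * w x / S)).
      by rewrite ler_wpM2r// ?ler_norm// !mulr_ge0// invr_ge0 ltW.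
    by rewrite !mulr_ge0// invr_ge0 ltW.
  apply: le_trans (lerD (lexx _) a1) _; rewrite -subr_ge0.
  have -> : - (2 * M * w x * ((1 - x) * (c / S ^+ 2))) -
      (- (2 * M * S^-1 * S^-1) + `|a| * (2 * M * w x / S)) =
      2 * M / S ^+ 2 * (1 - w x * ((1 - x) * c + `|a| * S)).
    by field; lra.
  rewrite mulr_ge0//; first by rewrite divr_ge0 ?mulr_ge0// ?exprn_ge0// ?ltW.
  have A0 : 0 <= `|a| * S by rewrite mulr_ge0// ltW.
  have yc0 : 0 <= (1 - x) * c by rewrite mulr_ge0//; lra.
  have yc1 : (1 - x) * c <= 1/4 by nra.
  rewrite subr_ge0; apply: le_trans (_ : 1 * (1/4 + 1/2) <= 1); last by lra.
  by rewrite ler_pM// ?addr_ge0// lerD.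
Unshelve. all: by end_near. Qed.

Lemma barrier_continuous t x : 0 < c * t + d ->
  {for (t, x), continuous (fun p => barrier p.1 `|p.2|)}.
Proof.
move=> S0; apply: cvgD; last exact: cvg_cst.
apply: cvgM; first exact: cvg_cst.
apply: cvgB; first exact: cvg_cst.
have C : {for (t, x), continuous
    (fun p : R * R => Num.max 0 (1 - (1 - `|p.2|) / (c * p.1 + d)))}.
  apply: (@continuous_max _ _ (cst 0)
    (fun p : R * R => 1 - (1 - `|p.2|) / (c * p.1 + d))); first exact: cvg_cst.
  apply: cvgB; first exact: cvg_cst.
  apply: cvgM.
    by apply: cvgB; [exact: cvg_cst|apply: cvg_norm; exact: cvg_snd].
  apply: cvgV; first by rewrite gt_eqF.
  apply: cvgD; last exact: cvg_cst.
  by apply: cvgM; [exact: cvg_cst|exact: cvg_fst].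
by apply: cvgM; exact: C.
Qed.

End Barrier.

(** * A priori bounds for the solution, up to a linear bound at time 1 *)

Section Solution_bounds.
Context {R : realType}.
Variables (a : R) (u0 : R -> R) (u : R -> R -> R).
Hypothesis (u0_C0 : C0_plus u0) (u_sol : classical_solution a u0 u).
Implicit Types (s T t x M : R).

Lemma solution_subsolution : subsolution a u.
Proof.
split; first exact: sol_derivable_t u_sol.
- exact: sol_derivable_x u_sol.
- exact: sol_derivable_xx u_sol.
- by move=> t x /(sol_equation u_sol) ->.
Qed.

(** Changing the sign of [u] changes the sign of [a]; comparing [- u] with 0 then yields
    non-negativity. *)
Lemma solution_opp_subsolution : subsolution (- a) (fun t x => - u t x).
Proof.
have dt t x : Q_infty (t, x) ->
    is_derive t 1 (fun s => - u s x) (- derive1 (u ^~ x) t).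
  move=> Q; apply/is_deriveN/is_derive_derive1.
  exact: sol_derivable_t u_sol _ _ Q.
have dx t x : Q_infty (t, x) ->
    is_derive x 1 (fun y => - u t y) (- derive1 (u t) x).
  move=> Q; apply/is_deriveN/is_derive_derive1.
  exact: sol_derivable_x u_sol _ _ Q.
have dxx t x : Q_infty (t, x) ->
    is_derive x 1 (derive1 (fun y => - u t y)) (- derive1 (derive1 (u t)) x).
  move=> Q; apply: (@near_eq_is_derive _ _ _ (fun y => - derive1 (u t) y)).
    case: Q => /= t0 x1.
    near=> y; have Qty : Q_infty (t, y).
      by split => //=; apply/andP; split; near: y;
        [apply: lt_nbhsr|apply: lt_nbhsl]; lra.
    by rewrite [RHS]derive1E; have [_ ->] := dx _ _ Qty.
  by apply/is_deriveN/is_derive_derive1; exact: sol_derivable_xx u_sol _ _ Q.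
split=> t x Q.
- by have [] := dt _ _ Q.
- by have [] := dx _ _ Q.
- by have [] := dxx _ _ Q.
- have -> : derive1 (fun s => - u s x) t = - derive1 (u ^~ x) t.
    by rewrite [LHS]derive1E; have [_ ->] := dt _ _ Q.
  have -> : derive1 (derive1 (fun y => - u t y)) x = - derive1 (derive1 (u t)) x.
    by rewrite [LHS]derive1E; have [_ ->] := dxx _ _ Q.
  have -> : `|derive1 (fun y => - u t y) x| = `|derive1 (u t) x|.
    by rewrite [X in `|X|]derive1E; have [_ ->] := dx _ _ Q; rewrite normrN.
  by have := sol_equation u_sol Q; lra.
Unshelve. all: by end_near. Qed.

Lemma solution_boundary0 t : 0 <= t -> u t (-1) = 0 /\ u t 1 = 0.
Proof.
rewrite le_eqVlt => /predU1P[<-|/(sol_boundary u_sol)//].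
have [_ _ u0N1 u01] := u0_C0.
by rewrite !(sol_initial u_sol) ?u0N1 ?u01//; lra.
Qed.

Lemma solution_continuous_slab s T : 0 <= s ->
  {within `[s, T] `*` `[-1, 1], continuous (fun p => u p.1 p.2)}.
Proof.
move=> s0; apply: continuous_subspaceW (sol_continuous u_sol).
by move=> [t x] [/=]; rewrite !in_itv/= => ? ?; split => //=; lra.
Qed.

Lemma supersolution_cst b M t x : supersolution_at b (fun _ _ => M) t x.
Proof.
exists 0, 0, (cst 0); split => //.
- exact: is_derive_cst.
- by near=> y; exact: is_derive_cst.
- exact: is_derive_cst.
- by rewrite normr0 mulr0 addr0.
Unshelve. all: by end_near.
Qed.

Lemma solution_le M : (forall x, -1 <= x <= 1 -> u0 x <= M) ->
  forall t x, 0 <= t -> -1 <= x <= 1 -> u t x <= M.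
Proof.
move=> u0M t x t0 x1; have [_ _ _ u01] := u0_C0.
have M0 : 0 <= M by rewrite -u01 u0M//; lra.
apply: (comparison_principle _ _ (fun _ _ => M) 0 t solution_subsolution)
  => //; last lra.
- exact: solution_continuous_slab.
- by apply: continuous_subspaceT; exact: cst_continuous.
- by move=> y y1; rewrite (sol_initial u_sol)// u0M.
- by move=> s /andP[s0 _]; have [-> ->] := solution_boundary0 _ s0.
- by move=> *; exact: supersolution_cst.
Qed.

Lemma solution_ge0 t x : 0 <= t -> -1 <= x <= 1 -> 0 <= u t x.
Proof.
move=> t0 x1; rewrite -oppr_le0.
apply: (comparison_principle _ _ (fun _ _ => 0) 0 t
  solution_opp_subsolution) => //; last lra.
- by move=> p; apply: cvgN; exact: solution_continuous_slab.
- by apply: continuous_subspaceT; exact: cst_continuous.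
- move=> y y1; rewrite (sol_initial u_sol)// oppr_le0.
  by have [_ u0_ge0 _ _] := u0_C0; exact: u0_ge0.
- by move=> s /andP[s0 _]; have [-> ->] := solution_boundary0 _ s0; rewrite oppr0.
- by move=> *; exact: supersolution_cst.
Qed.

(** The [d] found here bounds the initial width of the barrier layer, inside which the barrier may
    be as small as [eps]. *)
Lemma initial_small_near_boundary (eps : R) : 0 < eps ->
  exists2 d, 0 < d & forall x, -1 <= x <= 1 -> 1 - `|x| < d -> u0 x <= eps.
Proof.
move=> eps0; have [u0C _ u0N1 u01] := u0_C0.
have lt11 : (-1 : R) < 1 by lra.
have [_ cN1 c1] := (continuous_within_itvP _ lt11).1 u0C.
rewrite u0N1 in cN1; rewrite u01 in c1.
have [d1 /= d10 H1] := cvgr_lt _ cN1 _ eps0.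
have [d2 /= d20 H2] := cvgr_lt _ c1 _ eps0.
exists (Num.min d1 d2) => [|x x1]; first by rewrite lt_min d10.
rewrite lt_min => /andP[xd1 xd2].
have [x0|x0] := leP 0 x.
  have [->|x_neq1] := eqVneq x 1; first by rewrite u01 ltW.
  have xlt1 : x < 1 by rewrite lt_neqAle x_neq1; lra.
  rewrite (ger0_norm x0) in xd2.
  by apply/ltW/H2 => //=; rewrite ger0_norm; lra.
have [->|x_neq1] := eqVneq x (-1); first by rewrite u0N1 ltW.
have xgt1 : -1 < x by rewrite lt_neqAle eq_sym x_neq1; lra.
rewrite (ltr0_norm x0) in xd1.
by apply/ltW/H1 => //=; rewrite ler0_norm; lra.
Qed.

(** The initial width [d] depends on [eps], but at time 1 the layer has width [c + d >= c], so the
    slope of the barrier at the boundary is at most [2 M / c = 8 (1 + |a|) M] uniformly in [eps]. *)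
Lemma solution_le_distance M x : (forall x, -1 <= x <= 1 -> u0 x <= M) ->
  -1 <= x <= 1 -> u 1 x <= 8 * (1 + `|a|) * M * (1 - `|x|).
Proof.
move=> u0M x1; apply/ler_addgt0Pr => eps eps0.
have [d' d'0 u0eps] := initial_small_near_boundary _ eps0.
(* Together with [d <= c], this keeps the width at most [2 c <= 1/2] up to time 1 and gives
   [|a| * 2 c <= 1/2], as [barrier_supersolution] requires. *)
pose c := (4 * (1 + `|a|))^-1; have a0 := normr_ge0 a.
have c0 : 0 < c by rewrite invr_gt0; lra.
have c1 : c <= 1/4 by rewrite div1r lef_pV2 ?posrE; lra.
have ca : `|a| * c <= 1/4.
  rewrite /c ler_pdivrMr; last by lra.
  by lra.
pose d := Num.min c d'; have d0 : 0 < d by rewrite lt_min c0.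
have dc : d <= c by rewrite ge_min lexx.
have [_ _ _ u01] := u0_C0.
have M0 : 0 <= M by rewrite -u01 u0M//; lra.
have absx1 (y : R) : -1 <= y <= 1 -> `|y| <= 1 by move=> y1; rewrite ler_norml.
have S0 t : 0 <= t -> 0 < c * t + d by move=> t0; rewrite ltr_wpDl ?mulr_ge0// ltW.
have := comparison_principle _ _ (barrier M eps c d) 0 1 solution_subsolution.
move=> /(_ (lexx _)) H.
have {H} : u 1 x <= barrier M eps c d 1 `|x|.
  apply: H => //; last by lra.
  - exact: solution_continuous_slab.
  - apply: continuous_in_subspaceT => -[t y]; rewrite inE => -[/=].
    rewrite in_itv/= => /andP[t0 _] _.
    exact/barrier_continuous/S0.
  - move=> y y1; rewrite (sol_initial u_sol)//.
    have [yd|yd] := ltP (1 - `|y|) d.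
      apply: le_trans (u0eps y y1 _) _; first
        by rewrite (lt_le_trans yd)// ge_min lexx orbT.
      rewrite barrierE mulr0 add0r//; last exact: ltW.
      rewrite lerDr mulr_ge0// subr_ge0 expr_le1//.
        by rewrite lerBlDr lerDl divr_ge0 ?subr_ge0 ?absx1// ltW.
      by rewrite subr_ge0 ler_pdivrMr//; lra.
    rewrite /barrier max_l; last first.
      by rewrite subr_le0 ler_pdivlMr ?mulr0 ?add0r// mul1r.
    by rewrite expr0n subr0 mulr1 (le_trans (u0M y y1))// lerDl ltW.
  - move=> t /andP[t0 _]; have [-> ->] := solution_boundary0 _ t0.
    have Wt : 0 <= barrier M eps c d t 1.
      rewrite barrierE ?subrr ?mul0r ?subr0 ?expr1n ?subrr ?mulr0 ?add0r ?ltW//;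
      exact: S0.
    by [].
  - move=> t y tI yI uW; have S1 : c * t + d <= 2 * c.
      have : c * t <= c * 1 by rewrite ler_pM2l//; lra.
      by lra.
    have aS : `|a| * (c * t + d) <= `|a| * (2 * c) by rewrite ler_wpM2l.
    have [yS|yS] := ltP (1 - y) (c * t + d).
      by apply: barrier_supersolution; lra.
    (* Outside the layer the barrier equals [M + eps], above the maximum of [u], so [W < u] is
       impossible. *)
    exfalso; have WM : barrier M eps c d t y = M + eps.
      rewrite /barrier max_l ?expr0n ?subr0 ?mulr1// subr_le0 ler_pdivlMr ?mul1r//.
      by apply: S0; lra.
    have uM z : -1 <= z <= 1 -> u t z <= M by apply: solution_le => //; lra.
    by case: uW; rewrite WM; [have := uM y|have := uM (- y)]; lra.
move=> /le_trans; apply.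
have cd0 : 0 < c * 1 + d by exact: S0.
rewrite /barrier lerD2r.
set z := (1 - `|x|) / (c * 1 + d).
have z0 : 0 <= z by rewrite divr_ge0 ?subr_ge0 ?absx1// ltW.
have zc : z <= (1 - `|x|) / c.
  rewrite ler_wpM2l ?subr_ge0 ?absx1// lef_pV2 ?posrE//; lra.
have cE : (1 - `|x|) / c = 4 * (1 + `|a|) * (1 - `|x|) by rewrite /c invrK mulrC.
apply: le_trans (_ : M * (2 * z) <= _); last first.
  have -> : 8 * (1 + `|a|) * M * (1 - `|x|) = M * (2 * ((1 - `|x|) / c)).
    by rewrite cE; ring.
  by rewrite ler_wpM2l// ler_pM2l.
(* The concave profile lies below its tangent at 0: [1 - max(0, 1 - z)^2 <= 2 z]. *)
rewrite ler_wpM2l//; case: (leP 0 (1 - z)) => z1.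
  by have := sqr_ge0 z; rewrite !expr2; lra.
by rewrite expr0n subr0; lra.
Qed.

End Solution_bounds.

(** * Exponential decay from a positive eigenfunction *)

Section Decay.
Context {R : realType}.
Variables (a al : R) (phi phi1 : R -> R).
Implicit Types k x : R.
Hypothesis phi_derive : forall x : R, is_derive x 1 phi (phi1 x).
Hypothesis phi1_derive : forall x : R, is_derive x 1 phi1 (- (al * phi x)).
Hypotheses (phi0 : a * phi 0 + 2 * phi1 0 = 0) (phi_1 : phi 1 = 0).
Hypotheses (phi1_1 : phi1 1 < 0) (phi_gt0 : forall x, 0 <= x < 1 -> 0 < phi x).

Let lam := a ^+ 2 / 4 + al.
Hypothesis lam_gt0 : 0 < lam.

Let ex (k x : R) := expR (k * x).

Let ex_derive k x : is_derive x 1 (ex k) (k * ex k x).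
Proof. exact: is_derive_expR_mull. Qed.

(* The substitution [Phi = e^(ax/2) phi] turns [- phi'' = al phi] into
   [- Phi'' + a Phi' = lam Phi], and the Robin condition into [Phi'(0) = 0]. *)
Let Phi x := ex (a / 2) x * phi x.
Let Phi1 x := ex (a / 2) x * (phi1 x + a / 2 * phi x).

Let Phi_derive x : is_derive x 1 Phi (Phi1 x).
Proof.
have := is_derive_mul _ _ _ _ _ (ex_derive (a / 2) x) (phi_derive x).
by move=> /is_derive_eq; apply; rewrite /Phi1; ring.
Qed.

Let Phi1_derive x : is_derive x 1 Phi1 (a * Phi1 x - lam * Phi x).
Proof.
have := is_derive_mul _ _ _ _ _ (ex_derive (a / 2) x)
  (is_deriveD (phi1_derive x) (is_derive_mull (a / 2) _ _ _ (phi_derive x))).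
by move=> /is_derive_eq; apply; rewrite /Phi1 /Phi /lam fctE; field.
Qed.

Let Phi1_0 : Phi1 0 = 0.
Proof.
rewrite /Phi1 /ex mulr0 expR0 mul1r.
have -> : phi1 0 + a / 2 * phi 0 = (a * phi 0 + 2 * phi1 0) / 2 by field.
by rewrite phi0 mul0r.
Qed.

(** The function [e^(-ax) Phi1] vanishes at 0 and has derivative [- lam e^(-ax) Phi], which is
    negative on [[0, 1)]. The sign allows [|Phi'|] to be replaced by [- Phi']. *)
Let Phi1_le0 x : 0 <= x < 1 -> Phi1 x <= 0.
Proof.
move=> /andP[x0 x1].
pose g (y : R) := ex (- a) y * Phi1 y.
have dg (y : R) : is_derive y 1 g (- (lam * (ex (- a) y * Phi y))).
  have := is_derive_mul _ _ _ _ _ (ex_derive (- a) y) (Phi1_derive y).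
  by move=> /is_derive_eq; apply; ring.
have [->|x_neq0] := eqVneq x 0; first by rewrite Phi1_0.
have x_gt0 : 0 < x by rewrite lt_neqAle eq_sym x_neq0.
have [||c cI] := @MVT R g (fun y => - (lam * (ex (- a) y * Phi y))) 0 x.
- exact: x_gt0.
- by apply: derivable_within_continuous => y _; have [] := dg y.
rewrite {1 2}/g Phi1_0 mulr0 !subr0 => gx.
move: cI; rewrite in_itv/= => /andP[c0 cx].
rewrite -(pmulr_rle0 _ (expR_gt0 (- a * x))) -/(ex _ _) gx.
rewrite mulr_le0_ge0// oppr_le0 !mulr_ge0// ?expR_ge0// ltW//.
by apply: phi_gt0; lra.
Qed.

(** Near 1 the negative slope of [phi] gives the bound; on the remaining compact interval [phi] has
    a positive minimum and [1 - x <= 1]. *)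
Let phi_linear_lower :
  exists2 k, 0 < k & forall x, 0 <= x <= 1 -> k * (1 - x) <= phi x.
Proof.
(* Taking half of the slope leaves [phi (1 - h) - m h] with the positive derivative [m] at
   [h = 0]. *)
have [m m0 mE] : exists2 m, 0 < m & phi1 1 = - m - m.
  by exists (- phi1 1 / 2); [rewrite divr_gt0 ?oppr_gt0|field].
have d1 : is_derive (0 : R) 1 (fun h => phi (1 - h) - m * h) m.
  have mE' : phi1 (1 - 0) * - 1 - m * 1 = m by rewrite subr0 mE; ring.
  rewrite -[X in is_derive _ _ _ X]mE'.
  apply: is_deriveB.
  apply: (@is_derive1_comp _ phi (fun h => 1 - h)).
  exact: is_derive_subl.
have [e /= e0 He] := gt0_derive_right _ _ _ d1 m0.
pose e' := Num.min e 1 / 2.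
have e'0 : 0 < e' by rewrite divr_gt0// lt_min e0/=.
have e'e : e' < e by rewrite ltr_pdivrMr// gt_min; apply/orP; left; lra.
have e'1 : e' < 1 by rewrite ltr_pdivrMr// gt_min; apply/orP; right; lra.
have [||c cI phic] := @EVT_min R phi 0 (1 - e').
- by lra.
- by apply: derivable_within_continuous => y _; have [] := phi_derive y.
move: cI; rewrite in_itv/= => /andP[c0 c1].
have phic0 : 0 < phi c by apply: phi_gt0; lra.
exists (Num.min (phi c) (m)) => [|x /andP[x0 x1]].
  by rewrite lt_min phic0/=; lra.
have [xe|xe] := leP x (1 - e').
  apply: le_trans (phic x _); last by rewrite in_itv/= x0.
  rewrite -[leRHS]mulr1 ler_pM//; try lra.
  - by rewrite le_min; apply/andP; split; lra.
  - by rewrite ge_min lexx.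
have [->|x_neq1] := eqVneq x 1; first by rewrite subrr mulr0 phi_1.
have xlt1 : x < 1 by rewrite lt_neqAle x_neq1.
have : phi (1 - 0) - m * 0 <
    phi (1 - (1 - x)) - m * (1 - x).
  by apply: He; rewrite /= ?sub0r ?normrN ?ger0_norm; lra.
rewrite subr0 phi_1 subKr mulr0 subr0 => phix.
apply: le_trans (_ : m * (1 - x) <= _); last by lra.
by rewrite ler_wpM2r ?ge_min ?lexx ?orbT//; lra.
Qed.

(** At time 1, [u] is below a multiple of [1 - |x|], hence below a multiple of [Phi(|x|)];
    comparison propagates this with the factor [e^(- lam (t - 1))]. *)
Lemma decay_of_positive_eigenfunction :
  exists2 C, 0 < C & forall (u0 : R -> R) (u : R -> R -> R) (M : R),
    C0_plus u0 -> classical_solution a u0 u ->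
    (forall x, -1 <= x <= 1 -> u0 x <= M) ->
    forall t x, 1 <= t -> -1 <= x <= 1 -> u t x <= C * M * expR (- lam * t).
Proof.
have [k k0 phik] := phi_linear_lower.
have Phi_cont : continuous Phi := is_derive_continuous _ _ Phi_derive.
have [||c _ Phic] := @EVT_max R Phi 0 1; first by [].
  exact: continuous_subspaceT.
(* On [[0, 1]] the factor [e^(ax/2)] is at least [e^(-|a|/2)], whatever the sign of [a]. *)
pose k' := expR (- (`|a| / 2)) * k.
have k'0 : 0 < k' by rewrite mulr_gt0// expR_gt0.
have Phik x : 0 <= x <= 1 -> k' * (1 - x) <= Phi x.
  move=> x01; rewrite -mulrA ler_pM ?expR_ge0 ?phik ?mulr_ge0//; try lra.
  rewrite ler_expR -mulNr mulrAC; case/andP: x01 => x0 x1.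
  have := ler_norm (- a); rewrite normrN => na.
  have : 0 <= (a + `|a|) * x by rewrite mulr_ge0//; lra.
  have : 0 <= `|a| * (1 - x) by rewrite mulr_ge0//; lra.
  lra.
have Phic0 : 0 < Phi c.
  apply: lt_le_trans (Phic 0 _); last by rewrite in_itv/= lexx ler01.
  by rewrite mulr_gt0 ?expR_gt0// phi_gt0//; lra.
have a0 := normr_ge0 a.
(* The quotient converts the linear bound at time 1 into a multiple of [Phi], [Phi c] is the maximum
   of [Phi] on [[0, 1]], and [expR lam] undoes the time shift by 1. *)
exists (8 * (1 + `|a|) / k' * Phi c * expR lam).
  by rewrite mulr_gt0 ?expR_gt0// mulr_gt0// divr_gt0// mulr_gt0//; lra.
move=> u0 u M u0_C0 u_sol u0M t x t1 x1.
have M0 : 0 <= M by have [_ _ _ <-] := u0_C0; apply: u0M; lra.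
pose A := 8 * (1 + `|a|) / k' * M.
have A0 : 0 <= A.
  by rewrite mulr_ge0// divr_ge0 ?(ltW k'0)// mulr_ge0//; lra.
pose W (s y : R) := A * ex (- lam) (s - 1) * Phi y.
have absx (y : R) : -1 <= y <= 1 -> 0 <= `|y| <= 1.
  by move=> y1; rewrite normr_ge0 ler_norml.
have uW : u t x <= W t `|x|.
  apply: (comparison_principle a _ W 1 t
    (solution_subsolution _ _ _ u_sol)) => //; last lra.
  - exact: solution_continuous_slab u_sol _ _ ler01.
  - apply: continuous_subspaceT => p; rewrite /W /ex.
    apply: cvgM; last first.
      apply: (@continuous_comp _ _ _ (fun q : R * R => `|q.2|) Phi).
        by apply: cvg_norm; exact: cvg_snd.
      exact: Phi_cont.
    apply: cvgM; first exact: cvg_cst.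
    apply: (@continuous_comp _ _ _ (fun q : R * R => - lam * (q.1 - 1)) expR);
      last exact: continuous_expR.
    apply: cvgM; first exact: cvg_cst.
    by apply: cvgB; [exact: cvg_fst|exact: cvg_cst].
  - move=> y y1.
    apply: le_trans (solution_le_distance _ _ _ u0_C0 u_sol _ _ u0M y1) _.
    rewrite /W /ex subrr mulr0 expR0 mulr1.
    apply: le_trans (_ : A * (k' * (1 - `|y|)) <= _); last first.
      by rewrite ler_wpM2l// Phik// absx.
    by rewrite le_eqVlt; apply/orP; left; apply/eqP; rewrite /A; field; lra.
  - move=> s /andP[s1 _].
    have [-> ->] := solution_boundary0 _ _ _ u0_C0 u_sol s ltac:(lra).
    by rewrite /W /Phi phi_1 !mulr0.
  (* [W] satisfies the equation exactly: [Phi1 <= 0] gives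
     [a Phi1 - lam Phi + a |Phi1| = - lam Phi]. *)
  - move=> s y _ y01 _.
    exists (- (lam * W s y)), (A * ex (- lam) (s - 1) * (a * Phi1 y - lam * Phi y)).
    exists (fun z => A * ex (- lam) (s - 1) * Phi1 z); split.
    + rewrite /W.
      have := is_derive_mul _ _ s _ _ (is_derive_mull A _ _ _
        (@is_derive1_comp _ (ex (- lam)) (fun s => s - 1) s _ 1
          (ex_derive (- lam) (s - 1))
          (is_derive_addr id (-1) s 1 (is_derive_id s 1))))
        (is_derive_cst (Phi y) s 1).
      by move=> /is_derive_eq; apply; rewrite /W /=; ring.
    + by near=> z; exact: is_derive_mull.
    + exact: is_derive_mull.
    + by move=> ->; rewrite Phi1_0 mulr0.
    + have B0 : 0 <= A * ex (- lam) (s - 1) by rewrite mulr_ge0 ?expR_ge0.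
      rewrite normrM (ger0_norm B0) (ler0_norm (Phi1_le0 _ y01)) /W.
      by rewrite le_eqVlt; apply/orP; left; apply/eqP; ring.
apply: (le_trans uW); rewrite /W /ex.
have -> : - lam * (t - 1) = lam + - lam * t by ring.
rewrite expRD.
have -> : 8 * (1 + `|a|) / k' * Phi c * expR lam * M * expR (- lam * t) =
  A * (expR lam * expR (- lam * t)) * Phi c by rewrite /A; ring.
apply: ler_wpM2l; first by rewrite -expRD mulr_ge0// expR_ge0.
by apply: Phic; rewrite in_itv/= absx.
Unshelve. all: by end_near. Qed.

End Decay.

(** * An explicit positive eigenfunction in the variable [1 - x] *)

Section Eigenfunction.
Context {R : realType}.
Implicit Types a k x y : R.

Let sin_derive k x : is_derive x 1 (fun y => sin (k * y)) (k * cos (k * x)).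
Proof.
have := is_derive1_comp (is_derive_sin (k * x))
  (is_derive_mull k _ _ _ (is_derive_id x 1)).
by rewrite mulr1 mulrC.
Qed.

Let cos_derive k x : is_derive x 1 (fun y => cos (k * y)) (- (k * sin (k * x))).
Proof.
have := is_derive1_comp (is_derive_cos (k * x))
  (is_derive_mull k _ _ _ (is_derive_id x 1)).
by rewrite mulr1 mulrC mulrN.
Qed.

(** The positive slope at 0 makes [f] positive at some small [d > 0]; the intermediate value theorem
    on [[d, b]] then avoids the trivial root 0. *)
Lemma root_of_increasing_at0 (f f1 : R -> R) (b : R) : 0 < b ->
  (forall x, is_derive x 1 f (f1 x)) -> f 0 = 0 -> 0 < f1 0 -> f b < 0 ->
  exists2 k, 0 < k < b & f k = 0.
Proof.
move=> b0 fd f0 f10 fb.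
have [e /= e0 He] := gt0_derive_right _ _ _ (fd 0) f10.
pose d := Num.min e b / 2.
have d0 : 0 < d by rewrite divr_gt0// lt_min e0.
have de : d < e by rewrite ltr_pdivrMr// gt_min; apply/orP; left; lra.
have db : d < b by rewrite ltr_pdivrMr// gt_min; apply/orP; right; lra.
have fd0 : 0 < f d by rewrite -f0; apply: He => //=; rewrite sub0r normrN gtr0_norm.
have [|||k kI fk] := @IVT R f d b 0; first exact: ltW.
- by apply: derivable_within_continuous => y _; have [] := fd y.
- by rewrite ge_min le_max (ltW fb) (ltW fd0) orbT.
exists k => //; move: kI; rewrite in_itv/= => /andP[dk kb].
apply/andP; split; first by lra.
by rewrite lt_neqAle kb andbT; apply/eqP => kE; move: fb; rewrite -kE fk ltxx.
Qed.

Lemma robin_eigenfunction a : exists (al : R) (psi psi1 : R -> R),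
  [/\ forall x, is_derive x 1 psi (psi1 x),
      forall x, is_derive x 1 psi1 (- (al * psi x)),
      psi 0 = 0, a * psi 1 = 2 * psi1 1 &
      [/\ 0 < psi1 0, forall x, 0 < x <= 1 -> 0 < psi x &
          0 < a ^+ 2 / 4 + al]].
Proof.
have [a_lt2|a_gt2|->] := ltgtP a 2.
(* Robin condition for [sin (k y)]: the slope at 0 is [2 - a > 0] and the value at [pi] is [- 2 pi].
   The bound [k < pi] makes the sine positive on [(0, 1]]. *)
- have [||||k /andP[k0 kpi] fk] := @root_of_increasing_at0
    (fun x => 2 * x * cos x - a * sin x)
    (fun x => 2 * cos x - 2 * x * sin x - a * cos x) pi (pi_gt0 R).
  + move=> x.
    have := is_deriveB (is_derive_mul _ _ _ _ _
      (is_derive_mull 2 _ _ _ (is_derive_id x 1)) (is_derive_cos x))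
      (is_derive_mull a _ _ _ (is_derive_sin x)).
    by move=> /is_derive_eq; apply; ring.
  + by rewrite mulr0 sin0 mul0r mulr0 subrr.
  + by rewrite mulr0 mul0r cos0; lra.
  + by rewrite cospi sinpi; have := pi_gt0 R; lra.
  exists (k ^+ 2), (fun y => sin (k * y)), (fun y => k * cos (k * y));
    split => [//|x|||].
  + have := is_derive_mull k _ _ _ (cos_derive k x).
    by move=> /is_derive_eq; apply; ring.
  + by rewrite mulr0 sin0.
  + by rewrite mulr1; lra.
  + split; first by rewrite mulr0 cos0 mulr1.
    * move=> x /andP[x0 x1]; apply: sin_gt0_pi; rewrite mulr_gt0//=.
      by apply: le_lt_trans kpi; rewrite ler_piMr// ltW.
    * by rewrite ltr_wpDl ?exprn_gt0// divr_ge0// sqr_ge0.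
(* Robin condition for [2 sinh (k y)], with slope [2 a - 4 > 0] at 0. The endpoint [a / 2] is chosen
   so that [k < a / 2], which gives [a^2 / 4 - k^2 > 0]. *)
- have [|||||k /andP[k0 ka] fk] := @root_of_increasing_at0
    (fun x => a * (expR (1 * x) - expR (-1 * x)) -
              2 * x * (expR (1 * x) + expR (-1 * x)))
    (fun x => a * (1 * expR (1 * x) - -1 * expR (-1 * x)) -
       2 * (expR (1 * x) + expR (-1 * x)) -
       2 * x * (1 * expR (1 * x) + -1 * expR (-1 * x))) (a / 2).
  + by lra.
  + move=> x.
    have := is_deriveB
      (is_derive_mull a _ _ _
        (is_deriveB (is_derive_expR_mull 1 x) (is_derive_expR_mull (-1) x)))
      (is_derive_mul _ _ _ _ _
        (is_derive_mull 2 _ _ _ (is_derive_id x 1))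
        (is_deriveD (is_derive_expR_mull 1 x) (is_derive_expR_mull (-1) x))).
    by move=> /is_derive_eq; apply; rewrite !fctE; ring.
  + by rewrite !mulr0 expR0; ring.
  + by rewrite !mulr0 expR0; lra.
  + rewrite mul1r mulN1r.
    have -> : a * (expR (a / 2) - expR (- (a / 2))) -
        2 * (a / 2) * (expR (a / 2) + expR (- (a / 2))) =
        - (2 * a * expR (- (a / 2))) by field.
    by rewrite oppr_lt0 mulr_gt0 ?expR_gt0//; lra.
  exists (- k ^+ 2), (fun y => expR (k * y) - expR (- k * y)),
    (fun y => k * (expR (k * y) + expR (- k * y))); split => [x|x|||].
  + have := is_deriveB (is_derive_expR_mull k x) (is_derive_expR_mull (- k) x).
    by move=> /is_derive_eq; apply; ring.
  + have := is_derive_mull k _ _ _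
      (is_deriveD (is_derive_expR_mull k x) (is_derive_expR_mull (- k) x)).
    by move=> /is_derive_eq; apply; ring.
  + by rewrite !mulr0 subrr.
  + by move: fk; rewrite !mulr1 mul1r mulN1r; lra.
  + split; first by rewrite !mulr0 expR0 mulr_gt0//; lra.
    * move=> x /andP[x0 x1]; rewrite subr_gt0 ltr_expR.
      by have := mulr_gt0 k0 x0; rewrite mulNr; lra.
    * have -> : a ^+ 2 / 4 + - k ^+ 2 = (a / 2 - k) * (a / 2 + k) by field.
      by rewrite mulr_gt0//; lra.
- exists 0, id, (cst 1); split => [x|x|||]//=.
  + exact: is_derive_id.
  + by rewrite mul0r oppr0; exact: is_derive_cst.
  + by rewrite expr2; split=> [//|x /andP[]//|]; lra.
Qed.

End Eigenfunction.

(** * The essential supremum norm and pointwise bounds *)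

Section Sup_norm.
Context {R : realType}.
Notation mu := (@lebesgue_measure R).

Lemma ae_exists_itv (P : R -> Prop) (x y : R) : x < y ->
  (\forall z \ae mu, P z) -> exists2 z, x < z < y & P z.
Proof.
move=> xy [N [mN N0 PN]]; apply: contrapT => noz.
have xyN : `]x, y[%classic `<=` N.
  move=> z /=; rewrite in_itv/= => zI; apply: PN => /= Pz.
  by apply: noz; exists z.
have : (mu `]x, y[%classic <= mu N)%E by apply: le_measure; rewrite ?inE.
rewrite N0 lebesgue_measure_itv/= lte_fin xy -EFinB lee_fin.
by rewrite leNgt subr_gt0 xy.
Qed.

(** [Lnorm] at exponent [+oo] is an essential supremum only if the whole space has positive measure;
    this settles that case distinction. *)
Lemma lebesgue_measure_setT_gt0 : (0 < mu [set: R])%E.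
Proof.
apply: (@lt_le_trans _ _ (mu `]0, 1[%classic)).
  by rewrite lebesgue_measure_itv/= lte_fin ltr01 oppr0 adde0 lte_fin.
by apply: le_measure; rewrite ?inE.
Qed.

Lemma Linfty_norm_le (f : R -> R) (B : R) : 0 <= B ->
  (forall x, -1 < x < 1 -> `|f x| <= B) -> (Linfty_norm f <= B%:E)%E.
Proof.
move=> B0 fB; rewrite /Linfty_norm unlock /= lebesgue_measure_setT_gt0.
apply/ess_supP; apply: aeW => x /=; rewrite lee_fin /zero_extension patchE.
case: ifPn => [|_]; last by rewrite normr0.
by rewrite inE/= in_itv/=; exact: fB.
Qed.

(** A maximum at an endpoint is 0. At an interior maximum, a norm [r < f c] would be exceeded on a
    whole neighbourhood of [c], which is not a null set. *)
Lemma C0_plus_le_Linfty_norm (f : R -> R) : C0_plus f ->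
  exists2 M, forall x, -1 <= x <= 1 -> f x <= M & (M%:E <= Linfty_norm f)%E.
Proof.
move=> [fC f0 fN1 f1].
have lt11 : (-1 : R) < 1 by lra.
have [c cI fc] := EVT_max (ltW lt11) fC.
exists (f c) => [x x1|]; first by apply: fc; rewrite in_itv.
have norm_ge0 : (0 <= Linfty_norm f)%E by exact: Lnorm_ge0.
have [->|cN1] := eqVneq c (-1); first by rewrite fN1.
have [->|c1] := eqVneq c 1; first by rewrite f1.
have {}cI : c \in `]-1, 1[.
  by move: cI; rewrite !in_itv/= !lt_neqAle c1 (eq_sym (-1)) cN1.
rewrite leNgt; apply/negP => fc_gt.
move: norm_ge0 fc_gt; case normE : Linfty_norm => [r| |]//.
rewrite lee_fin lte_fin => r0 rfc.
have [fI _ _] := (continuous_within_itvP _ lt11).1 fC.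
have [e /= e0 He] := cvgr_gt _ (fI _ cI) _ rfc.
have [d /= d0 Hd] := near_in_itvoo cI.
pose m := Num.min e d; have m0 : 0 < m by rewrite lt_min e0.
have ae_le := ess_sup_ge mu (abse \o (EFin \o zero_extension `]-1, 1[%classic f)).
have [|x xI] := ae_exists_itv _ (c - m) (c + m) _ ae_le; first by lra.
have xm : `|c - x| < m by rewrite ltr_norml; lra.
have xd : x \in `]-1, 1[
  by apply: Hd => /=; rewrite (lt_le_trans xm)// ge_min lexx orbT.
have xe : r < f x by apply: He => /=; rewrite (lt_le_trans xm)// ge_min lexx.
move: normE; rewrite /Linfty_norm unlock /= lebesgue_measure_setT_gt0 => ->.
rewrite /= /zero_extension patchE ifT; last by rewrite inE.
by rewrite lee_fin leNgt (lt_le_trans xe)// ler_norm.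
Qed.

End Sup_norm.

(** * Classical eigenfunctions are eigenfunctions of the weakly defined [L] *)

Section Weak_eigenvalue.
Context {R : realType}.
Notation mu := (@lebesgue_measure R).
Implicit Types f g phi : R -> R.

Lemma Rintegral_oo_cc f (x y : R) : continuous f ->
  \int[mu]_(z in `]x, y[) f z = \int[mu]_(z in `[x, y]) f z.
Proof.
move=> fC.
have int_cc : mu.-integrable `[x, y] (EFin \o f).
  apply: continuous_compact_integrable; first exact: segment_compact.
  exact: continuous_subspaceT.
rewrite Rintegral_itv_bndo_bndc; last first.
  by apply: integrableS int_cc => //; exact: subset_itv_oo_cc.
rewrite Rintegral_itv_obnd_cbnd//.
by apply: integrableS int_cc => //; exact: subset_itv_oc_cc.
Qed.

Lemma continuous_in_L2 f : continuous f -> in_L2_01 f.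
Proof.
move=> fC; rewrite /in_L2_01 /zero_extension.
have f2C : continuous (fun x => f x ^+ 2) by move=> x; apply: cvgM; exact: fC.
have int_cc : mu.-integrable `[0, 1] (EFin \o (fun x => f x ^+ 2)).
  apply: continuous_compact_integrable; first exact: segment_compact.
  exact: continuous_subspaceT.
have int_oo : mu.-integrable `]0, 1[ (EFin \o (fun x => f x ^+ 2)).
  by apply: integrableS int_cc => //; exact: subset_itv_oo_cc.
rewrite inE; apply/andP; split; rewrite inE /=.
  apply: (measurable_restrictT _ _).1 => //; apply: measurable_funTS.
  exact: continuous_measurable_fun.
rewrite /finite_norm unlock /=; apply: poweR_lty.
rewrite (_ : (fun x => _) = (EFin \o (fun x => f x ^+ 2)) \_ `]0, 1[%classic).
  rewrite -integral_mkcond.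
  exact: integrable_lty int_oo.
apply/funext => x; rewrite /= !patchE; case: ifPn => _ /=.
  by rewrite powR_mulrn// real_normK// num_real.
by rewrite normr0 powR0.
Qed.

(** Integration by parts on [[0, 1]]; the boundary terms vanish because the support of a test
    function lies in the open interval. *)
Lemma weak_derivative_of_derivable f (f1 : R -> R) :
  (forall x : R, is_derive x 1 f (f1 x)) -> continuous f1 ->
  weak_derivative_01 f f1.
Proof.
move=> fd f1C psi [psid psi1C psi_supp].
have fC : continuous f := is_derive_continuous _ _ fd.
have psiC : continuous psi :=
  is_derive_continuous _ _ (fun x => is_derive_derive1 _ _ (psid x)).
have psi0 z : ~ z \in `]0, 1[ -> psi z = 0.
  move=> z01; apply: contrapT => /eqP psiz.
  by apply: z01; apply: psi_supp; exact: subset_closure.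
rewrite !Rintegral_oo_cc; last 2 first.
- by move=> x; apply: cvgM; [exact: f1C|exact: psiC].
- by move=> x; apply: cvgM; [exact: fC|exact: psi1C].
have LR (h : R -> R) : (forall x, derivable h x 1) ->
    derivable_oo_LRcontinuous h 0 1.
  move=> hd; have hC : continuous h :=
    is_derive_continuous _ _ (fun x => is_derive_derive1 _ _ (hd x)).
  split=> [x _||]; first exact: hd.
    exact/cvg_at_right_filter/hC.
  exact/cvg_at_left_filter/hC.
rewrite (@Rintegration_by_parts _ f psi f1 (derive1 psi) 0 1)//.
- by rewrite !psi0 ?mulr0 ?subr0 ?sub0r//= in_itv/= ?ltxx// andbF.
- exact: continuous_subspaceT.
- by apply: LR => x; have [] := fd x.
- by move=> x _; rewrite derive1E; have [] := fd x.
- exact: continuous_subspaceT.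
- exact: LR.
Qed.

Lemma classical_eigenvalue (a al : R) phi (phi1 : R -> R) :
  (forall x : R, is_derive x 1 phi (phi1 x)) ->
  (forall x : R, is_derive x 1 phi1 (- (al * phi x))) ->
  a * phi 0 + 2 * phi1 0 = 0 -> phi 1 = 0 ->
  (forall x, 0 < x < 1 -> phi x != 0) -> eigenvalue_L a al.
Proof.
move=> phid phi1d bc0 bc1 phi_neq0.
have phiC : continuous phi := is_derive_continuous _ _ phid.
have phi1C : continuous phi1 := is_derive_continuous _ _ phi1d.
have phi2C : continuous (fun x => - (al * phi x)).
  by move=> x; apply: cvgN; apply: cvgM; [exact: cvg_cst|exact: phiC].
have rep f : continuous f -> continuous_representative_01 f f.
  by move=> fC; split; [exact: continuous_subspaceT|exact: aeW].
exists phi; split.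
  move=> /(ae_exists_itv _ 0 1 ltr01)[x x01] /=.
  by rewrite in_itv/= => /(_ x01)/eqP; exact/negP/phi_neq0.
exists phi1, (fun x => - (al * phi x)); split.
- split; [exact: continuous_in_L2..| |]; exact: weak_derivative_of_derivable.
- by exists phi, phi1; split => //; exact: rep.
- by apply: aeW => x _; rewrite opprK.
Qed.

End Weak_eigenvalue.

(** * The decay estimate with the first eigenvalue *)

Theorem theorem1p4 (R : realType) (a : R) (a_neq0 : a != 0)
    (alpha1 : R) (alpha1_first : first_eigenvalue_L a alpha1) :
  exists gamma : R, 0 < gamma /\
    forall (u0 : R -> R) (u : R -> R -> R),
      C0_plus u0 -> classical_solution a u0 u ->
      forall t : R, 1 <= t ->
        (Linfty_norm (u t) <=
           gamma%:E * Linfty_norm u0 *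
             (expR (- (a ^+ 2 / 4 + alpha1) * t))%:E)%E.
Proof.
have [al [psi [psi1 [dpsi dpsi1 psi0 bc [psi10 psi_gt0 lam0]]]]] :=
  robin_eigenfunction a.
(* The reflection moves the Dirichlet condition to 1 and the Robin condition to 0, as in the domain
   of [L]. *)
pose phi (x : R) := psi (1 - x).
pose phi1 (x : R) := - psi1 (1 - x).
have comp_derive (f f1 : R -> R) (x : R) :
    (forall y : R, is_derive y 1 f (f1 y)) ->
    is_derive x 1 (fun y => f (1 - y)) (- f1 (1 - x)).
  move=> fd; rewrite -mulrN1.
  exact: (@is_derive1_comp _ f (fun y => 1 - y) x _ _ (fd _)
    (is_derive_subl 1 _ _ _ (is_derive_id x 1))).
have dphi (x : R) : is_derive x 1 phi (phi1 x) by exact: comp_derive.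
have dphi1 (x : R) : is_derive x 1 phi1 (- (al * phi x)).
  rewrite -[- _]opprK; apply: is_deriveN.
  exact: (comp_derive psi1 (fun y => - (al * psi y))).
have bc0 : a * phi 0 + 2 * phi1 0 = 0.
  by rewrite /phi /phi1 subr0 mulrN bc subrr.
have bc1 : phi 1 = 0 by rewrite /phi subrr.
have phi_gt0 x : 0 <= x < 1 -> 0 < phi x by move=> x01; apply: psi_gt0; lra.
have al_le : alpha1 <= al.
  apply: alpha1_first.2; apply: classical_eigenvalue dphi dphi1 bc0 bc1 _.
  by move=> x x01; rewrite gt_eqF// phi_gt0//; lra.
have phi1_1 : phi1 1 < 0 by rewrite /phi1 subrr oppr_lt0.
have [C C0 decay] :=
  decay_of_positive_eigenfunction _ _ _ _ dphi dphi1 bc0 bc1 phi1_1 phi_gt0 lam0.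
exists C; split=> // u0 u u0_C0 u_sol t t1.
have [M u0M Mnorm] := C0_plus_le_Linfty_norm _ u0_C0.
have M0 : 0 <= M by have [_ _ _ <-] := u0_C0; apply: u0M; lra.
set E := expR _.
have E0 : 0 < E by exact: expR_gt0.
apply: (@le_trans _ _ (C%:E * M%:E * E%:E)%E); last first.
  apply: lee_wpmul2r; first by rewrite lee_fin ltW.
  by apply: lee_wpmul2l => //; rewrite lee_fin ltW.
rewrite -!EFinM; apply: Linfty_norm_le; first by rewrite !mulr_ge0// ltW.
move=> x x1; have x1' : -1 <= x <= 1 by lra.
rewrite ger0_norm; last by apply: (solution_ge0 _ _ _ u0_C0 u_sol) => //; lra.
apply: le_trans (decay _ _ _ u0_C0 u_sol u0M _ _ t1 x1') _.
apply: ler_wpM2l; first by rewrite mulr_ge0// ltW.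
(* Since [alpha1 <= al], decay at the rate given by [al] is at least as fast. *)
rewrite ler_expR; apply: ler_wpM2r; first by lra.
by rewrite lerN2 lerD2l.
Qed.
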